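(* Let $N=\{1,\dots,n\}$ be a set of $n\ge1$ agents and $M$ a set of $m$ indivisible goods with $k=\lfloor m/n\rfloor\ge2$. There exists a deterministic truthful mechanism $\mathcal{X}$, defined on all profiles $\boldsymbol v=(v_1,\dots,v_n)$ of additive leveled valuations on $M$, such that for every such profile the allocation $\mathcal{X}(\boldsymbol v)$ is both EFX and $\frac{k-1}{k}$-MMS.
   Context: A valuation $v:2^M\to\mathbb{R}_{\ge0}$ is additive if $v(S)=\sum_{g\in S}v(\{g\})$ for all $S\subseteq M$, and leveled if $v(S)>v(T)$ for all $S,T\subseteq M$ with $|S|>|T|$. $\Pi_n(M)$ is the set of all tuples $(A_1,\dots,A_n)$ of pairwise disjoint (possibly empty) subsets of $M$ whose union is $M$ (allocations). A deterministic mechanism (without payments) is a map $\mathcal{X}$ from valuation profiles in the given domain to $\Pi_n(M)$; $\mathcal{X}_i(\boldsymbol v)$ is agent $i$'s bundle. It is truthful if $v_i(\mathcal{X}_i(\boldsymbol v))\ge v_i(\mathcal{X}_i(v_i',v_{-i}))$ for every profile $\boldsymbol v$, agent $i$, and valuation $v_i'$ in the domain. An allocation $A$ is EFX if $v_i(A_i)\ge v_i(A_j\setminus\{g\})$ for all $i,j\in N$, $g\in A_j$. It is $\alpha$-MMS if $v_i(A_i)\ge\alpha\,\mu_i^n(M)$ for all $i$, where $\mu_i^n(M)=\max_{A\in\Pi_n(M)}\min_{l\in\{1,\dots,n\}}v_i(A_l)$. *)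

(* Defs.v *)
From HB Require Import structures.
From mathcomp Require Import all_boot all_order all_algebra.
From mathcomp Require Import interval_inference reals.

Set Implicit Arguments.
Unset Strict Implicit.
Unset Printing Implicit Defensive.

Import Order.TTheory GRing.Theory Num.Theory.
Local Open Scope ring_scope.

(* Agents are the elements of 'I_n, goods those of a finite type M. *)

Definition valuation (R : realType) (M : finType) := {set M} -> {nonneg R}.

Definition additive (R : realType) (M : finType) (v : valuation R M) : Prop :=
  forall S : {set M}, (v S)%:num = \sum_(g in S) (v [set g])%:num.

Definition leveled (R : realType) (M : finType) (v : valuation R M) : Prop :=
  forall S T : {set M}, (#|T| < #|S|)%N -> (v T)%:num < (v S)%:num.

Definition additive_leveled (R : realType) (M : finType)
    (v : valuation R M) : Prop :=
  additive v /\ leveled v.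

Definition is_allocation (n : nat) (M : finType)
    (A : {ffun 'I_n -> {set M}}) : bool :=
  [forall i, forall j, (i != j) ==> [disjoint A i & A j]]
  && (\bigcup_i A i == [set: M]).

Definition allocation (n : nat) (M : finType) :=
  {A : {ffun 'I_n -> {set M}} | is_allocation A}.

Definition bundle (n : nat) (M : finType) (A : allocation n M) (i : 'I_n) :
    {set M} :=
  val A i.

Definition profile (R : realType) (n : nat) (M : finType)
    (D : valuation R M -> Prop) :=
  'I_n -> {v : valuation R M | D v}.

Definition mechanism (R : realType) (n : nat) (M : finType)
    (D : valuation R M -> Prop) :=
  profile n D -> allocation n M.

(* The profile (v'_i, v_{-i}). *)
Definition deviate (R : realType) (n : nat) (M : finType)
    (D : valuation R M -> Prop) (v : profile n D) (i : 'I_n)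
    (v' : {v : valuation R M | D v}) : profile n D :=
  fun j => if j == i then v' else v j.

Definition truthful (R : realType) (n : nat) (M : finType)
    (D : valuation R M -> Prop) (X : mechanism n D) : Prop :=
  forall (v : profile n D) (i : 'I_n) (v' : {v : valuation R M | D v}),
    (sval (v i) (bundle (X (deviate v i v')) i))%:num
      <= (sval (v i) (bundle (X v) i))%:num.

Definition EFX (R : realType) (n : nat) (M : finType)
    (v : 'I_n -> valuation R M) (A : allocation n M) : Prop :=
  forall (i j : 'I_n) (g : M), g \in bundle A j ->
    (v i (bundle A j :\ g))%:num <= (v i (bundle A i))%:num.

(* The minimum is seeded with the value of the bundle of an arbitrary index
   l0, so it is exactly the minimum over all l and does not depend on l0.  The
   maximum is seeded with 0, which is harmless: values are nonnegative, and
   allocations exist since 'I_n is inhabited by l0. *)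
Definition maximin_share (R : realType) (n : nat) (M : finType)
    (v : valuation R M) (l0 : 'I_n) : R :=
  \big[Num.max/0]_(A : allocation n M)
    \big[Num.min/(v (bundle A l0))%:num]_(l < n) (v (bundle A l))%:num.

Definition approx_MMS (R : realType) (n : nat) (M : finType) (alpha : R)
    (v : 'I_n -> valuation R M) (A : allocation n M) : Prop :=
  forall i : 'I_n, alpha * maximin_share (v i) i <= (v i (bundle A i))%:num.

(* Main.v *)
Require Import Defs.
From HB Require Import structures.
From mathcomp Require Import all_boot all_order all_algebra.
From mathcomp Require Import interval_inference reals.
From mathcomp Require Import zify ring.

Set Implicit Arguments.
Unset Strict Implicit.
Unset Printing Implicit Defensive.

Import Order.TTheory GRing.Theory Num.Theory.
Local Open Scope ring_scope.

(** Serial dictatorship with quotas: agents choose in turn a most valuable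
    bundle of prescribed size among the remaining goods, and the [m mod n]
    agents entitled to [k + 1] goods come last, the others taking [k].
    Reports influence neither quotas nor the goods left by predecessors, whence
    truthfulness.  For EFX, removing a good from a bundle leaves fewer goods
    than the envious agent owns, except when an agent with [k] goods looks at
    one with [k + 1], who chose later, so that [k] of these goods were
    available.  For MMS, every allocation has a bundle [B] with at most [k]
    goods; if [B] has exactly [k], summing [v (B :\ g) <= v A] over [g] in [B]
    yields [(k - 1) v B <= k v A]. *)

Section SerialDictatorship.
Variables (n : nat) (M : finType).
Implicit Types (c : 'I_n -> {set M} -> {set M}) (t : nat).

(** Turns are natural numbers rather than agents, so that [unclaimed c n], the goods left after the
    last turn, makes sense; [set0] serves for turns beyond the last agent. *)
Fixpoint unclaimed c t : {set M} :=
  if t is t'.+1 then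
    unclaimed c t' :\: (if insub t' is Some i then c i (unclaimed c t') else set0)
  else setT.

Definition serial_bundles c : {ffun 'I_n -> {set M}} :=
  [ffun i : 'I_n => c i (unclaimed c i)].

Lemma unclaimedS c (i : 'I_n) :
  unclaimed c i.+1 = unclaimed c i :\: serial_bundles c i.
Proof. by rewrite /= valK ffunE. Qed.

Lemma unclaimed_sub c s t : (s <= t)%N -> unclaimed c t \subset unclaimed c s.
Proof.
move=> /subnK <-; elim: (t - s)%N => [|d IHd] //.
exact: subset_trans (subsetDl _ _) IHd.
Qed.

(** Truthfulness rests on this: a report cannot alter the goods from which its author chooses. *)
Lemma eq_unclaimed c c' t :
  (forall j : 'I_n, (j < t)%N -> c j =1 c' j) -> unclaimed c t = unclaimed c' t.
Proof.
elim: t => [|t IHt] //= eq_c; rewrite -IHt => [|j ltjt]; last first.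
  by apply: eq_c; apply: ltnW.
by case: insubP => // i _ def_t; rewrite eq_c // def_t.
Qed.

(** The agents with [n - i <= r] are the last [r], so among the [n - t] agents still to choose,
    [minn r (n - t)] take an extra good. *)
Lemma card_unclaimed c k r :
    #|M| = (n * k + r)%N -> (r <= n)%N ->
    (forall (i : 'I_n) (S : {set M}), c i S \subset S) ->
    (forall (i : 'I_n) (S : {set M}), (k + (n - i <= r) <= #|S|)%N ->
      #|c i S| = (k + (n - i <= r))%N) ->
  forall t, (t <= n)%N -> #|unclaimed c t| = ((n - t) * k + minn r (n - t))%N.
Proof.
move=> cardM lern c_sub c_card; elim=> [|t IHt] ltn.
  by rewrite cardsT subn0 cardM (minn_idPl lern).
pose i := Ordinal ltn; rewrite -[t]/(val i) unclaimedS ffunE.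
have {IHt} := IHt (ltnW ltn); rewrite -[t]/(val i) => IHt.
have def_nt : (n - i = (n - i.+1).+1)%N by rewrite subnSK.
rewrite cardsD (setIidPr (c_sub _ _)) c_card IHt def_nt mulSn.
  by move: (n - _)%N (_ * k)%N => d p; lia.
by move: (n - _)%N (_ * k)%N => d p; lia.
Qed.

Lemma serial_bundles_allocation c :
    (forall (i : 'I_n) (S : {set M}), c i S \subset S) ->
    unclaimed c n = set0 ->
  is_allocation (serial_bundles c).
Proof.
move=> c_sub rest0.
have lt_disj (i j : 'I_n) : (i < j)%N ->
    [disjoint serial_bundles c i & serial_bundles c j].
  move=> ltij; apply: (@disjointWr _ _ (unclaimed c j)).
    by rewrite [serial_bundles c j]ffunE.
  apply: disjointWr (unclaimed_sub c ltij) _.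
  by rewrite unclaimedS disjoint_sym -setI_eq0 setIDAC -setIDA setDv setI0.
apply/andP; split.
  apply/forallP=> i; apply/forallP=> j; apply/implyP => neij.
  have [/lt_disj//|/lt_disj|/val_inj eqij] := ltngtP i j.
    by rewrite disjoint_sym.
  by rewrite eqij eqxx in neij.
rewrite eqEsubset subsetT /=; apply/subsetP=> g _.
have claimed t : (t <= n)%N -> g \notin unclaimed c t ->
    exists i, g \in serial_bundles c i.
  elim: t => [|t IHt] ltn; first by rewrite inE.
  rewrite -[t]/(val (Ordinal ltn)) unclaimedS in_setD negb_and negbK.
  by case/orP => [gi|/(IHt (ltnW ltn))//]; exists (Ordinal ltn).
have [|i gi] := claimed n (leqnn n); first by rewrite rest0 inE.
by apply/bigcupP; exists i.
Qed.

End SerialDictatorship.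

Section Valuations.
Variables (R : realType) (M : finType) (v : valuation R M).
Implicit Types (S T : {set M}) (q : nat).

(** Bounding the size by [q] instead of fixing it keeps [set0] admissible for every [S]; for leveled
    [v] the maximizer still has exactly [q] goods whenever [S] has that many. *)
Definition best q S : {set M} :=
  [arg max_(T > set0 | (T \subset S) && (#|T| <= q)%N) (v T)%:num]%O.

Lemma bestP q S :
  [/\ best q S \subset S, (#|best q S| <= q)%N &
      forall T, T \subset S -> (#|T| <= q)%N -> (v T)%:num <= (v (best q S))%:num].
Proof.
rewrite /best; case: arg_maxP => [|B /andP[sBS leBq] maxB].
  by rewrite sub0set cards0.
by split=> // T sTS leTq; apply: maxB; rewrite sTS.
Qed.

Lemma card_best q S : leveled v -> (q <= #|S|)%N -> #|best q S| = q.
Proof.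
move=> lev leqS; have [sBS leBq maxB] := bestP q S.
apply/eqP; rewrite eqn_leq leBq leqNgt; apply/negP=> ltBq.
have /properP[_ [g gS gB]] : best q S \proper S.
  by rewrite properEcard sBS (leq_trans ltBq).
have := maxB (g |: best q S); rewrite subUset sub1set gS sBS cardsU1 gB.
by move=> /(_ isT ltBq); rewrite leNgt lev // cardsU1 gB.
Qed.

Lemma leveled_MMS_bound k S T :
    additive_leveled v -> (0 < k)%N -> (#|T| <= k)%N -> (k <= #|S|)%N ->
  (k%:R - 1) / k%:R * (v T)%:num <= (v S)%:num.
Proof.
move=> [add lev] k0; rewrite leq_eqVlt => /predU1P[cardT|ltTk] lekS.
  have kR : 0 < k%:R :> R by rewrite ltr0n.
  rewrite mulrAC ler_pdivrMr //.
  (* Each good of [T] is missing from exactly one of the [k] sets [T :\ g]. *)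
  have <- : \sum_(g in T) (v (T :\ g))%:num = (k%:R - 1) * (v T)%:num.
    under eq_bigr => g gT.
      have -> : (v (T :\ g))%:num = (v T)%:num - (v [set g])%:num.
        by rewrite [in RHS]add (big_setD1 g) //= -add; ring.
      over.
    by rewrite sumrB sumr_const cardT -add mulrBl mul1r mulr_natl.
  rewrite mulr_natr -[in leRHS]cardT -sumr_const.
  apply: ler_sum => g gT; apply/ltW/lev.
  by rewrite (cardsD1 g) gT in cardT; lia.
(* Now [T] has fewer goods than [S], so leveledness suffices and the factor only lowers the left
   side. *)
have k1 : (k%:R - 1) / k%:R <= 1 :> R.
  by rewrite ler_pdivrMr ?ltr0n // mul1r gerBl.
apply: le_trans (ltW (lev S T (leq_trans ltTk lekS))).
by rewrite ler_piMl.
Qed.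

End Valuations.

(** Pigeonhole: otherwise the disjoint bundles would hold at least [n * q.+1] goods. *)
Lemma allocation_small_bundle (n : nat) (M : finType) (A : allocation n M) q :
  (#|M| < n * q.+1)%N -> exists i, (#|bundle A i| <= q)%N.
Proof.
move=> ltMn; apply/existsP; apply: contraLR ltMn; rewrite negb_exists -leqNgt.
move=> /forallP big_A; have /andP[/forallP disA /eqP covA] := valP A.
rewrite -cardsT -covA -sum1_card.
rewrite partition_disjoint_bigcup => [|i j neij]; last first.
  exact: implyP (forallP (disA i) j) neij.
rewrite -[n in (n * _)%N]card_ord -sum_nat_const.
by apply: leq_sum => i _; rewrite sum1_card ltnNge big_A.
Qed.

(** The condition [0 <= x] accounts for the seed 0 of the maximum. *)
Lemma maximin_share_le (R : realType) (n : nat) (M : finType)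
    (v : valuation R M) (l0 : 'I_n) (x : R) :
    0 <= x -> (forall A : allocation n M, exists i, (v (bundle A i))%:num <= x) ->
  maximin_share v l0 <= x.
Proof.
move=> x0 small; rewrite /maximin_share; apply: bigmax_le => // A _.
have [i] := small A; apply: le_trans; exact: bigmin_le_cond.
Qed.

Theorem corollary4 (R : realType) (n : nat) (M : finType) (k : nat)
    (hn : (1 <= n)%N) (hk : k = (#|M| %/ n)%N) (hk2 : (2 <= k)%N) :
  exists X : mechanism n (@additive_leveled R M),
    truthful X /\
    forall v : profile n (@additive_leveled R M),
      EFX (fun i => sval (v i)) (X v) /\
      approx_MMS ((k%:R - 1) / k%:R) (fun i => sval (v i)) (X v).
Proof.
pose r := (#|M| %% n)%N; pose quota (i : 'I_n) := (k + (n - i <= r))%N.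
have ltrn : (r < n)%N by rewrite ltn_mod.
have cardM : #|M| = (n * k + r)%N by rewrite mulnC hk -divn_eq.
pose c (v : profile n (@additive_leveled R M)) i := best (sval (v i)) (quota i).
have c_sub v i S : c v i S \subset S by case: (bestP (sval (v i)) (quota i) S).
have c_card v i (S : {set M}) : (quota i <= #|S|)%N -> #|c v i S| = quota i.
  by apply: card_best; case: (svalP (v i)).
have c_max (v : profile n (@additive_leveled R M)) i (S T : {set M}) :
    T \subset S -> (#|T| <= quota i)%N ->
    (sval (v i) T)%:num <= (sval (v i) (c v i S))%:num.
  by case: (bestP (sval (v i)) (quota i) S) => _ _; apply.
have card_rest v :=
  card_unclaimed cardM (ltnW ltrn) (c_sub v) (c_card v).
have alloc v : is_allocation (serial_bundles (c v)).
  apply: serial_bundles_allocation (c_sub v) _.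
  by apply/eqP; rewrite -cards_eq0 card_rest // subnn minn0.
pose X v : allocation n M := Sub _ (alloc v).
have XE v i : bundle (X v) i = c v i (unclaimed (c v) i).
  by rewrite /bundle /= ffunE.
have cardX v i : #|bundle (X v) i| = quota i.
  rewrite XE c_card // card_rest ?(ltnW (ltn_ord i)) //.
  have := ltn_ord i; rewrite /quota -subn_gt0.
  by case: (n - i)%N => // d _; rewrite mulSn; case: leqP; lia.
exists X; split=> [v i v'|v].
  (* Both reports face the same remaining goods, and a lie only yields another subset of them within
     the same quota. *)
  rewrite !XE (@eq_unclaimed _ _ _ (c v)) => [|j ltji S]; last first.
    by rewrite /c /deviate ifN // neq_ltn ltji.
  apply: c_max; first exact: c_sub.
  by case: (bestP (sval (deviate v i v' i)) (quota i) (unclaimed (c v) i)).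
split=> [i j g gj|i].
  have [_ lev] := svalP (v i).
  have cardj : (#|bundle (X v) j :\ g|).+1 = quota j.
    by rewrite -(cardX v) [RHS](cardsD1 g) gj.
  have [lt_ji|le_ij] := ltnP #|bundle (X v) j :\ g| (quota i).
    by apply/ltW/lev; rewrite cardX.
  (* Here [quota i < quota j], that is, [n - j <= r < n - i]. *)
  have ltij : (i < j)%N.
    by move: le_ij cardj; rewrite /quota; lia.
  rewrite [in leRHS]XE; apply: c_max; last by rewrite -ltnS cardj /quota; lia.
  apply: subset_trans (subsetDl _ _) _; rewrite XE.
  exact: subset_trans (c_sub _ _ _) (unclaimed_sub _ (ltnW ltij)).
have k_gt0 : (0 < k)%N by apply: ltnW.
have a_gt0 : 0 < (k%:R - 1) / k%:R :> R.
  by rewrite divr_gt0 ?ltr0n // subr_gt0 ltr1n.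
(* Moving the positive factor to the right leaves a bound to check on one bundle of each
   allocation. *)
rewrite mulrC -ler_pdivlMr //; apply: maximin_share_le => [|A].
  by rewrite divr_ge0 // ltW.
have [|l lel] := allocation_small_bundle A (q := k).
  by rewrite mulnS cardM addnC ltn_add2r.
exists l; rewrite ler_pdivlMr // mulrC.
apply: leveled_MMS_bound => //; first exact: svalP (v i).
by rewrite cardX leq_addr.
Qed.
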